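(* Let $(X,d,A)$ be a separable metric pair, let $E$ be a complex Banach space, and let $f\colon K(X,A)\to E$ be Lipschitz. Let $A\subseteq Y_n\subseteq X$ ($n\ge1$) be uniformly discrete subpairs such that the image of $Y_n/A$ in $X/A$ is an $\varepsilon_n$-net for $\overline d_1$, where $\varepsilon_n\downarrow0$. For every subpair $A\subseteq Z\subseteq X$ let $P_n^Z\colon K(Z,A)\to K(Y_n,A)$ ($n\geq 1$) be group homomorphisms with $\rho(i_{Y_n}P_n^Z\xi,\,i_Z\xi)\to0$ as $n\to\infty$ for every $\xi\in K(Z,A)$. Suppose: 1. For every $n$ and every $\lambda\in E^*$, the function $\lambda\circ f\circ i_{Y_n}$ belongs to $B(K(Y_n,A))$, with representing measure $\mu_{n,\lambda}$, a finite complex regular Borel measure on $\widehat{K(Y_n,A)}$. 2. For every uniformly discrete subpair $A\subseteq Z\subseteq X$ and every $\lambda\in E^*$, the pushforward measures $\nu_{n,\lambda}^Z:=(\widehat{P_n^Z})_\#\mu_{n,\lambda}$ on $\widehat{K(Z,A)}$ satisfy $\sup_n\|\nu_{n,\lambda}^Z\|_{\mathrm{TV}}<\infty$, where $\widehat{P_n^Z}(\chi)=\chi\circ P_n^Z$. Then $f$ has uniformly discrete spectral synthesis.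
   Context: Virtual persistence diagrams. A metric pair $(X,d,A)$ is a metric space $(X,d)$ with a nonempty subset $A\subseteq X$; it is separable if $X$ is. Let $q\colon X\to X/A$ collapse $A$ to one point $[A]$, put $d(x,A)=\inf_{a\in A}d(x,a)$ and $d_1(x,y)=\min\{d(x,y),\,d(x,A)+d(y,A)\}$. The induced distance $\overline d_1(q(x),q(y))=d_1(x,y)$ on $X/A$ is taken to be a metric (equivalently, $A$ is closed). $D(X)$ is the free commutative monoid on $X$, and $D(X,A)=D(X)/D(A)\cong D(X\setminus A)$. A matching between $\alpha,\beta\in D(X,A)$ is $\sigma=\sum_{i=1}^n(x_i,y_i)\in D(X\times X)$ with $\sum_i x_i=\alpha$ and $\sum_i y_i=\beta$ modulo $D(A)$; $W_1(\alpha,\beta)=\inf_\sigma\sum_i d_1(x_i,y_i)$. $K(X,A)$ is the Grothendieck group of $D(X,A)$ (elements $\alpha-\beta$) with the translation-invariant metric $\rho(\alpha-\beta,\gamma-\delta)=W_1(\alpha+\delta,\gamma+\beta)$; Lipschitz maps on $K(X,A)$ are with respect to $\rho$. Subpairs. A subpair $A\subseteq Z\subseteq X$ is a metric pair with the restricted metric; $i_Z\colon K(Z,A)\to K(X,A)$ is the homomorphism induced by inclusion. The subpair is uniformly discrete if there is $\eta>0$ such that distinct classes in $Z/A$ are at $\overline d_1$-distance at least $\eta$; then $K(Z,A)$ is a discrete group. Harmonic analysis on a discrete abelian group $G$. $\widehat G$ is the compact group of homomorphisms $G\to\mathbb T$. $B(G)$ is the set of functions $x\mapsto\int_{\widehat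 G}\chi(x)\,d\mu(\chi)$ with $\mu$ a finite complex regular Borel measure on $\widehat G$ (the representing measure). $C(G)$ is the space of all functions $G\to\mathbb C$ with pointwise convergence. A variety on $G$ is a closed complex linear subspace of $C(G)$ invariant under all translations $(\tau_yu)(x)=u(x+y)$; the variety $\operatorname{Var}_G(\mathcal F)$ generated by a family $\mathcal F$ is the smallest variety containing it. An exponential monomial is a function $p\,m$, with $p$ a polynomial in finitely many additive functions $G\to\mathbb C$ and $m\colon G\to\mathbb C^\times$ a homomorphism. A variety is synthesizable if the exponential monomials it contains span a dense subspace of it. Uniformly discrete spectral synthesis. For a uniformly discrete subpair $A\subseteq Z\subseteq X$ put $V_Z(f)=\operatorname{Var}_{K(Z,A)}\{\lambda\circ f\circ i_Z:\lambda\in E^*\}$. The Lipschitz function $f$ has uniformly discrete spectral synthesis if $V_Z(f)$ is synthesizable for every uniformly discrete subpair $A\subseteq Z\subseteq X$. *)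

(* Defs.v *)
From HB Require Import structures.
From mathcomp Require Import all_boot all_order all_algebra.
From mathcomp Require Import finmap multiset generic_quotient complex.
From mathcomp Require mpoly.
From mathcomp Require Import all_classical all_reals all_analysis.

Set Implicit Arguments.
Unset Strict Implicit.
Unset Printing Implicit Defensive.

Import Order.TTheory GRing.Theory Num.Theory.
Import numFieldNormedType.Exports.

Local Open Scope classical_set_scope.
Local Open Scope ring_scope.

Section collapse.
Context (X : choiceType) (A : set X).

Definition collapse_rel : rel X :=
  fun x y => (x == y) || ((x \in A) && (y \in A)).

Lemma collapse_rel_refl : reflexive collapse_rel.
Proof. by move=> x; rewrite /collapse_rel eqxx. Qed.

Lemma collapse_rel_sym : symmetric collapse_rel.
Proof. by move=> x y; rewrite /collapse_rel eq_sym andbC. Qed.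

Lemma collapse_rel_trans : transitive collapse_rel.
Proof.
move=> y x z /orP[/eqP->//|/andP[xA yA]] /orP[/eqP<-|/andP[_ zA]].
  by rewrite /collapse_rel xA yA orbT.
by rewrite /collapse_rel xA zA orbT.
Qed.

Canonical collapse_equiv :=
  EquivRel collapse_rel collapse_rel_refl collapse_rel_sym collapse_rel_trans.

Definition collapse := {eq_quot collapse_rel}%qT.
HB.instance Definition _ : EqQuotient _ collapse_rel collapse :=
  EqQuotient.on collapse.
HB.instance Definition _ := Choice.on collapse.

Definition collapse_pi (x : X) : collapse := (\pi_collapse x)%qT.

Lemma collapse_piP (x y : X) :
  collapse_pi x = collapse_pi y <-> x = y \/ (A x /\ A y).
Proof.
split=> [/eqP|H].
  rewrite eqmodE => /orP[/eqP|/andP[/set_mem ? /set_mem ?]]; first by left.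
  by right.
apply/eqP; rewrite eqmodE /= /collapse_rel; apply/orP.
by case: H => [->|[Ax Ay]]; [left | right; rewrite !mem_set].
Qed.

End collapse.

Definition is_metric (R : realType) (T : Type) (rho : T -> T -> R) :=
  [/\ forall u v, 0 <= rho u v,
      forall u v, rho u v = 0 <-> u = v,
      forall u v, rho u v = rho v u &
      forall u v w, rho u w <= rho u v + rho v w].

Section distances.
Context (R : realType) (X : choiceType) (d : X -> X -> R) (A : set X).

Definition set_dist (x : X) : R := inf [set d x a | a in A].

Definition d1 (x y : X) : R := Order.min (d x y) (set_dist x + set_dist y).

Definition dbar1 (u v : collapse A) : R := d1 (repr u) (repr v).

End distances.

Lemma dbar1_pi (R : realType) (X : choiceType) (d : X -> X -> R) (A : set X) :
  is_metric d -> forall x y,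
  dbar1 d (collapse_pi A x) (collapse_pi A y) = d1 d A x y.
Proof.
case=> d_ge0 d_eq0 d_sym d_tri.
have lbS x : has_lbound [set d x a | a in A].
  by exists 0 => _ [a _ <-].
have S0 x : A x -> set_dist d A x = 0.
  move=> Ax; apply/eqP; rewrite eq_le; apply/andP; split.
    by apply: ge_inf => //; exists x => //; apply/d_eq0.
  by apply: lb_le_inf; [exists (d x x); exists x | move=> _ [a _ <-]].
have Sle x a : A a -> set_dist d A x <= d x a.
  by move=> Aa; apply: ge_inf => //; exists a.
have d1l x x' y : A x -> A x' -> d1 d A x y = d1 d A x' y.
  move=> Ax Ax'; rewrite /d1 (S0 x)// (S0 x')// !add0r !min_r //.
    by rewrite d_sym; exact: Sle.
  by rewrite d_sym; exact: Sle.
have d1r x y y' : A y -> A y' -> d1 d A x y = d1 d A x y'.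
  by move=> Ay Ay'; rewrite /d1 (S0 y)// (S0 y')// !addr0 !min_r //; exact: Sle.
move=> x y; rewrite /dbar1.
have /collapse_piP Hx : collapse_pi A (repr (collapse_pi A x)) = collapse_pi A x.
  by rewrite /collapse_pi reprK.
have /collapse_piP Hy : collapse_pi A (repr (collapse_pi A y)) = collapse_pi A y.
  by rewrite /collapse_pi reprK.
have -> : d1 d A (repr (collapse_pi A x)) (repr (collapse_pi A y)) =
          d1 d A x (repr (collapse_pi A y)).
  by case: Hx => [->//|[]]; exact: d1l.
by case: Hy => [->//|[]]; exact: d1r.
Qed.

(* The free commutative monoid D(X) is {mset X}; the submonoid D(A) is the set
   of multisets satisfying [supported A], and [dgm A] is D(X)/D(A). *)

Section diagrams.
Context (X : choiceType) (A : set X).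
Local Open Scope mset_scope.

Definition supported (a : {mset X}) := forall x, x \in a -> A x.

Definition dgm_rel : rel {mset X} := fun a b =>
  `[< exists s t : {mset X},
        [/\ supported s, supported t & a `+` s = b `+` t] >].

Lemma supported0 : supported mset0.
Proof. by move=> x; rewrite in_mset0. Qed.

Lemma supportedD s t : supported s -> supported t -> supported (s `+` t).
Proof.
by move=> ss st x; rewrite in_msetD => /orP[/ss|/st].
Qed.

Lemma dgm_rel_refl : reflexive dgm_rel.
Proof.
by move=> a; apply/asboolP; exists mset0, mset0; split => //; exact: supported0.
Qed.

Lemma dgm_rel_sym : symmetric dgm_rel.
Proof.
move=> a b; apply/asbool_equiv_eq.
by split=> -[s [t [ss st e]]]; exists t, s; split.
Qed.

Lemma dgm_rel_trans : transitive dgm_rel.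
Proof.
move=> b a c /asboolP[s [t [ss st e]]] /asboolP[s' [t' [ss' st' e']]].
apply/asboolP; exists (s `+` s'), (t' `+` t).
split; [exact: supportedD|exact: supportedD|].
by rewrite !msetDA e -e' msetDAC.
Qed.

Canonical dgm_equiv := EquivRel dgm_rel dgm_rel_refl dgm_rel_sym dgm_rel_trans.

Definition dgm := {eq_quot dgm_rel}%qT.
HB.instance Definition _ : EqQuotient _ dgm_rel dgm := EqQuotient.on dgm.
HB.instance Definition _ := Choice.on dgm.

Definition dgm_pi (a : {mset X}) : dgm := (\pi_dgm a)%qT.

Lemma dgm_piP a b : dgm_pi a = dgm_pi b <->
  exists s t : {mset X}, [/\ supported s, supported t & a `+` s = b `+` t].
Proof.
split=> [/eqP|H]; first by rewrite eqmodE => /asboolP.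
by apply/eqP; rewrite eqmodE; apply/asboolP.
Qed.

Lemma dgm_piK (u : dgm) : dgm_pi (repr u) = u.
Proof. exact: reprK. Qed.

Definition dgm_add (u v : dgm) : dgm := dgm_pi (repr u `+` repr v).

Lemma dgm_add_pi a b : dgm_add (dgm_pi a) (dgm_pi b) = dgm_pi (a `+` b).
Proof.
apply/dgm_piP.
have /dgm_piP[s [t [ss st e]]] := dgm_piK (dgm_pi a).
have /dgm_piP[s' [t' [ss' st' e']]] := dgm_piK (dgm_pi b).
exists (s `+` s'), (t `+` t'); split; [exact: supportedD|exact: supportedD|].
by rewrite msetDACA e e' msetDACA.
Qed.

Lemma dgm_addA : associative dgm_add.
Proof.
move=> u v w; rewrite -(dgm_piK u) -(dgm_piK v) -(dgm_piK w).
by rewrite !dgm_add_pi msetDA.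
Qed.

Lemma dgm_addC : commutative dgm_add.
Proof. by move=> u v; rewrite /dgm_add msetDC. Qed.

Lemma dgm_add0 : left_id (dgm_pi mset0) dgm_add.
Proof. by move=> u; rewrite -(dgm_piK u) dgm_add_pi mset0D. Qed.

HB.instance Definition _ := GRing.isNmodule.Build dgm dgm_addA dgm_addC dgm_add0.

Lemma dgm_piD a b : dgm_pi (a `+` b) = dgm_pi a + dgm_pi b.
Proof. by rewrite -dgm_add_pi. Qed.

Lemma dgm_pi0 : dgm_pi mset0 = 0.
Proof. by []. Qed.

End diagrams.

Section grothendieck.
Context (M : nmodType).

Definition groth_rel : rel (M * M) := fun p q =>
  `[< exists k, p.1 + q.2 + k = q.1 + p.2 + k >].

Lemma groth_rel_refl : reflexive groth_rel.
Proof. by move=> p; apply/asboolP; exists 0. Qed.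

Lemma groth_rel_sym : symmetric groth_rel.
Proof. by move=> p q; apply/asbool_equiv_eq; split=> -[k e]; exists k. Qed.

Lemma groth_rel_trans : transitive groth_rel.
Proof.
move=> q p r /asboolP[k e] /asboolP[l f]; apply/asboolP.
exists (q.1 + q.2 + k + l).
transitivity ((p.1 + q.2 + k) + (q.1 + r.2 + l)).
  by rewrite [RHS](AC (3*3) ((1*5)*(((4*2)*3)*6))) /=.
by rewrite e f [LHS](AC (3*3) ((4*2)*(((1*5)*3)*6))) /=.
Qed.

Canonical groth_equiv :=
  EquivRel groth_rel groth_rel_refl groth_rel_sym groth_rel_trans.

Definition groth := {eq_quot groth_rel}%qT.
HB.instance Definition _ : EqQuotient _ groth_rel groth := EqQuotient.on groth.
HB.instance Definition _ := Choice.on groth.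

(* groth_pi (a, b) is the formal difference a - b. *)
Definition groth_pi (p : M * M) : groth := (\pi_groth p)%qT.

Lemma groth_piP p q : groth_pi p = groth_pi q <->
  exists k, p.1 + q.2 + k = q.1 + p.2 + k.
Proof.
split=> [/eqP|H]; first by rewrite eqmodE => /asboolP.
by apply/eqP; rewrite eqmodE; apply/asboolP.
Qed.

Lemma groth_piK (u : groth) : groth_pi (repr u) = u.
Proof. exact: reprK. Qed.

Definition groth_add (u v : groth) : groth :=
  groth_pi ((repr u).1 + (repr v).1, (repr u).2 + (repr v).2).

Definition groth_opp (u : groth) : groth := groth_pi ((repr u).2, (repr u).1).

Lemma groth_add_pi p q :
  groth_add (groth_pi p) (groth_pi q) = groth_pi (p.1 + q.1, p.2 + q.2).
Proof.
apply/groth_piP => /=.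
have /groth_piP[k e] := groth_piK (groth_pi p).
have /groth_piP[l f] := groth_piK (groth_pi q).
exists (k + l).
by rewrite [LHS](AC (2*2*2) ((1*3*5)*(2*4*6))) /= e f
           [LHS](AC (3*3) ((1*4)*(2*5)*(3*6))) /=.
Qed.

Lemma groth_addA : associative groth_add.
Proof.
move=> u v w; rewrite -(groth_piK u) -(groth_piK v) -(groth_piK w).
by rewrite !groth_add_pi /= !addrA.
Qed.

Lemma groth_addC : commutative groth_add.
Proof.
by move=> u v; rewrite /groth_add [_.1 + _]addrC [_.2 + _]addrC.
Qed.

Lemma groth_add0 : left_id (groth_pi (0, 0)) groth_add.
Proof.
by move=> u; rewrite -(groth_piK u) groth_add_pi /= !add0r -surjective_pairing.
Qed.

Lemma groth_addN : left_inverse (groth_pi (0, 0)) groth_opp groth_add.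
Proof.
move=> u; rewrite -{2}(groth_piK u) /groth_opp groth_add_pi /=.
by apply/groth_piP; exists 0 => /=; rewrite !addr0 add0r addrC.
Qed.

HB.instance Definition _ := GRing.isZmodule.Build groth
  groth_addA groth_addC groth_add0 groth_addN.

End grothendieck.

(* K(X,A) *)
Definition vpd (X : choiceType) (A : set X) := groth (dgm A).
HB.instance Definition _ (X : choiceType) (A : set X) :=
  GRing.Zmodule.on (vpd A).

Section mset_map.
Context (X Y : choiceType) (f : Y -> X).
Local Open Scope mset_scope.

Definition mset_map (a : {mset Y}) : {mset X} := seq_mset [seq f y | y <- a].

Lemma mset_mapD a b : mset_map (a `+` b) = mset_map a `+` mset_map b.
Proof.
apply/msetP => x; rewrite msetE2 !mset_seqE -count_cat -map_cat.
apply/seq.permP; apply: perm_map; apply/allP => y _ /=.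
by rewrite count_cat !count_mem_mset msetE2.
Qed.

Lemma mset_map0 : mset_map mset0 = mset0.
Proof. by apply/msetP => x; rewrite mset_seqE enum_mset0 mset0E. Qed.

End mset_map.

Section induced.
Context (X Y : choiceType) (A : set X) (B : set Y) (f : Y -> X).

Definition dgm_map (u : dgm B) : dgm A := dgm_pi A (mset_map f (repr u)).

Definition vpd_map (xi : vpd B) : vpd A :=
  groth_pi (dgm_map (repr xi).1, dgm_map (repr xi).2).

Hypothesis fBA : B `<=` f @^-1` A.

Lemma supported_map a : supported B a -> supported A (mset_map f a).
Proof.
move=> sa x; rewrite -mset_neq0 mset_seqE -lt0n -has_count => /hasP[_ /mapP[y ya ->]].
by move=> /eqP <-; apply: fBA; exact: sa.
Qed.

Lemma dgm_map_pi a : dgm_map (dgm_pi B a) = dgm_pi A (mset_map f a).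
Proof.
apply/dgm_piP.
have /dgm_piP[s [t [ss st e]]] := dgm_piK (dgm_pi B a).
exists (mset_map f s), (mset_map f t).
by split; [exact: supported_map|exact: supported_map|rewrite -!mset_mapD e].
Qed.

Lemma dgm_mapD u v : dgm_map (u + v) = dgm_map u + dgm_map v.
Proof.
rewrite -(dgm_piK u) -(dgm_piK v) -dgm_piD !dgm_map_pi.
by rewrite mset_mapD dgm_piD.
Qed.

Lemma vpd_map_pi u v : vpd_map (groth_pi (u, v)) = groth_pi (dgm_map u, dgm_map v).
Proof.
apply/groth_piP => /=.
have /groth_piP[k /= e] := groth_piK (groth_pi (u, v)).
by exists (dgm_map k); rewrite -!dgm_mapD e.
Qed.

Lemma vpd_mapD xi zeta : vpd_map (xi + zeta) = vpd_map xi + vpd_map zeta.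
Proof.
rewrite -(groth_piK xi) -(groth_piK zeta).
case: (repr xi) (repr zeta) => [a b] [a' b'].
have addE (M : nmodType) (p q : M * M) :
  groth_pi p + groth_pi q = groth_pi (p.1 + q.1, p.2 + q.2) := groth_add_pi p q.
by rewrite addE !vpd_map_pi addE /= !dgm_mapD.
Qed.

End induced.

Section wasserstein.
Context (R : realType) (X : choiceType) (d : X -> X -> R) (A : set X).

Definition matching (a b : dgm A) : set {mset X * X}%mset :=
  [set s | dgm_pi A (mset_map fst s) = a /\ dgm_pi A (mset_map snd s) = b].

Definition W1 (a b : dgm A) : R :=
  inf [set \sum_(p <- (s : {mset X * X}%mset)) d1 d A p.1 p.2 | s in matching a b].

(* With xi = alpha - beta and zeta = gamma - delta this is
   W1 (alpha + delta) (gamma + beta) for a chosen representation of xi and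
   zeta; W1 being translation invariant, the choice is immaterial. *)
Definition rho (xi zeta : vpd A) : R :=
  W1 ((repr xi).1 + (repr zeta).2) ((repr zeta).1 + (repr xi).2).

End wasserstein.

Record subpair (X : choiceType) (A : set X) := Subpair {
  subpair_set :> set X ;
  subpair_sub : A `<=` subpair_set }.

Section subpairs.
Context (R : realType) (X : choiceType) (d : X -> X -> R) (A : set X).
Implicit Type Z : subpair A.

Definition sub_base Z : set Z := [set z | A (val z)].
Arguments sub_base : clear implicits.

Definition sub_dist Z (z w : Z) : R := d (val z) (val w).
Arguments sub_dist : clear implicits.

Definition sub_vpd Z : zmodType := vpd (sub_base Z).

Definition sub_incl Z : sub_vpd Z -> vpd A := vpd_map A val.
Arguments sub_incl : clear implicits.

Lemma sub_inclD Z : {morph sub_incl Z : xi zeta / xi + zeta}.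
Proof. by apply: vpd_mapD. Qed.

Definition uniformly_discrete Z := exists2 eta : R, 0 < eta &
  forall u v : collapse (sub_base Z),
    u <> v -> eta <= dbar1 (sub_dist Z) u v.

Definition collapse_incl Z (u : collapse (sub_base Z)) : collapse A :=
  collapse_pi A (val (repr u)).

Definition is_net (eps : R) Z := forall u : collapse A,
  exists v : collapse (sub_base Z), dbar1 d u (collapse_incl v) <= eps.

End subpairs.

Arguments sub_base {X A} Z.
Arguments sub_dist {R X} d {A} Z.
Arguments sub_incl {X A} Z.

Section dual_group.
Context (R : realType) (G : zmodType).

Definition is_character (chi : {ptws G -> R[i]^o}) :=
  (forall x y, chi (x + y) = chi x * chi y) /\ (forall x, `|chi x| = 1).

Definition dual_group := set_type [set chi | is_character chi].
HB.instance Definition _ := Topological.on dual_group.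

Lemma is_character1 : is_character (fun=> 1).
Proof. by split=> [x y|x]; rewrite ?mulr1 ?normr1. Qed.

Definition trivial_character : dual_group :=
  SigSub (mem_set (is_character1 : [set chi | is_character chi] (fun=> 1))).

HB.instance Definition _ := isPointed.Build dual_group trivial_character.

Definition borel_dual := g_sigma_algebraType (@open dual_group).
HB.instance Definition _ := Pointed.on borel_dual.
HB.instance Definition _ := Measurable.on borel_dual.

Lemma continuous_eval (x : G) :
  continuous (fun chi : dual_group => (val chi x : R[i]^o)).
Proof.
move=> chi; apply: (@continuous_comp dual_group {ptws G -> R[i]^o} R[i]^o val
  (fun h => h x)); first exact: initial_continuous.
exact: proj_continuous.
Qed.

End dual_group.

Section dual_map.
Context (R : realType) (G H : zmodType) (P : {additive G -> H}).

Lemma is_character_comp (chi : dual_group R H) :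
  is_character ((val chi : H -> R[i]^o) \o P).
Proof.
have /set_mem[chiD chi1] := valP chi.
by split=> [x y|x] /=; [rewrite raddfD; exact: chiD|exact: chi1].
Qed.

Definition dual_map (chi : dual_group R H) : dual_group R G :=
  SigSub (mem_set (is_character_comp chi : [set chi | is_character chi] _)).

Lemma dual_mapE chi x : val (dual_map chi) x = val chi (P x).
Proof. by []. Qed.

Lemma continuous_dual_map : continuous dual_map.
Proof.
apply: continuous_comp_initial => chi.
apply/cvg_sup; first exact/fmap_filter/(nbhs_filter chi).
move=> x U [V [[W oW <-] /= Wx WU]].
have evW := @continuous_eval R H (P x) chi W (open_nbhs_nbhs (conj oW Wx)).
suff : nbhs chi ((val \o dual_map) @^-1` U) by [].
have sWU : (fun chi' : dual_group R H => val chi' (P x) : R[i]^o) @^-1` W `<=`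
    (val \o dual_map) @^-1` U by move=> chi' Wchi'; apply: WU; exact: Wchi'.
exact: (filterS sWU evW).
Qed.

Lemma measurable_dual_map :
  measurable_fun setT (dual_map : borel_dual R H -> borel_dual R G).
Proof.
apply: (measurability
  (@open (dual_group R G) : set (set (borel_dual R G)))) => //.
move=> _ [U oU <-]; rewrite setTI; apply: sub_sigma_algebra.
have /continuousP cP := continuous_dual_map.
exact: (cP U oU).
Qed.

End dual_map.

Section complex_measure.
Context d (T : measurableType d) (R : realType).

(* A finite complex measure, given by its real and imaginary parts. *)
Record cmeasure := CMeasure {
  cmeasure_re : {charge set T -> \bar R} ;
  cmeasure_im : {charge set T -> \bar R} }.

Definition cmeasure_val (mu : cmeasure) (E : set T) : R[i] :=
  (fine (cmeasure_re mu E) +i* fine (cmeasure_im mu E))%C.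

(* The value does not depend on the chosen Hahn decomposition. *)
Definition charge_integral (nu : {charge set T -> \bar R}) (g : T -> R) : R :=
  let: exist P exP := cid (Hahn_decomposition nu) in
  let: exist N nuPN := cid exP in
  \int[jordan_pos nuPN]_x g x - \int[jordan_neg nuPN]_x g x.

Definition cintegral (mu : cmeasure) (h : T -> R[i]) : R[i] :=
  let re g := charge_integral (cmeasure_re mu) g in
  let im g := charge_integral (cmeasure_im mu) g in
  ((re (fun x => complex.Re (h x)) - im (fun x => complex.Im (h x))) +i*
   (re (fun x => complex.Im (h x)) + im (fun x => complex.Re (h x))))%C.

(* |mu|(E), as a supremum over finite measurable partitions of E *)
Definition variation (mu : cmeasure) (E : set T) : \bar R :=
  ereal_sup [set v | exists n (F : 'I_n -> set T),
    [/\ forall i, measurable (F i), trivIset setT F, \bigcup_i F i = E &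
        v = (\sum_i Normc.normc (cmeasure_val mu (F i)))%:E]].

Definition tv_norm (mu : cmeasure) : \bar R := variation mu setT.

End complex_measure.

Section cpushforward.
Context d d' (T : measurableType d) (T' : measurableType d') (R : realType).
Context (f : T -> T') (mf : measurable_fun setT f).

Definition charge_pushforward (nu : {charge set T -> \bar R}) :
    {charge set T' -> \bar R} :=
  measure_function_pushforward__canonical__charge_Charge nu mf.

Definition cpushforward (mu : cmeasure T R) : cmeasure T' R := CMeasure
  (charge_pushforward (cmeasure_re mu))
  (charge_pushforward (cmeasure_im mu)).

Lemma cpushforwardE mu E :
  cmeasure_val (cpushforward mu) E = cmeasure_val mu (f @^-1` E).
Proof. by []. Qed.

End cpushforward.

Section fourier_stieltjes.
Context (R : realType) (G : zmodType).

Definition regular (mu : cmeasure (borel_dual R G) R) :=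
  forall E : set (borel_dual R G), measurable E ->
    variation mu E = ereal_inf [set variation mu U |
      U in [set U | open (U : set (dual_group R G)) /\ E `<=` U]] /\
    variation mu E = ereal_sup [set variation mu K |
      K in [set K | compact (K : set (dual_group R G)) /\ K `<=` E]].

(* phi is in B(G) when it has a representing measure mu in this sense. *)
Definition represents (mu : cmeasure (borel_dual R G) R) (phi : G -> R[i]) :=
  regular mu /\
  forall x, phi x = cintegral mu (fun chi : borel_dual R G => val chi x).

End fourier_stieltjes.

Section synthesis.
Context (R : realType) (G : zmodType).
(* C(G), with pointwise convergence *)
Local Notation CG := {ptws G -> R[i]^o}.

Definition linear_subspace (V : set CG) :=
  V (fun=> 0) /\
  forall (c : R[i]) u v, V u -> V v -> V (fun x => c * u x + v x).

Definition is_variety (V : set CG) :=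
  [/\ closed V, linear_subspace V &
      forall y u, V u -> V (fun x => u (x + y))].

Definition Var (F : set CG) : set CG := smallest is_variety F.

Definition is_exponential (m : G -> R[i]) :=
  (forall x, m x != 0) /\ (forall x y, m (x + y) = m x * m y).

Definition exponential_monomial : set CG :=
  [set u | exists k (a : 'I_k -> {additive G -> R[i]})
             (p : mpoly.mpoly k R[i]) (m : G -> R[i]),
     is_exponential m /\
     u = (fun x => mpoly.meval (fun i => a i x) p * m x)].

Definition synthesizable (V : set CG) :=
  V `<=` closure (smallest linear_subspace (V `&` exponential_monomial)).

End synthesis.

Section banach.
Context (R : realType) (E : completeNormedModType R[i]).

Record topdual := Topdual {
  topdual_fun :> {linear E -> R[i]^o} ;
  _ : continuous topdual_fun }.

Section vpd_functions.
Context (X : choiceType) (d : X -> X -> R) (A : set X) (f : vpd A -> E).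

Definition vpd_lipschitz := exists L : R,
  forall xi zeta, `|f xi - f zeta| <= (L * rho d xi zeta)%:C%C.

Definition V_ (Z : subpair A) : set {ptws sub_vpd Z -> R[i]^o} :=
  Var (range (fun (lam : topdual) (xi : sub_vpd Z) => lam (f (sub_incl Z xi)))).
Arguments V_ : clear implicits.

Definition ud_spectral_synthesis :=
  forall Z : subpair A, uniformly_discrete d Z -> synthesizable (V_ Z).

End vpd_functions.
End banach.

(* Main.v *)
Require Import Defs.
From mathcomp Require Import all_boot all_order all_algebra.
From mathcomp Require Import complex ring.
From mathcomp Require mpoly.
From mathcomp Require Import all_classical all_reals all_analysis.
From mathcomp Require Import measurable_realfun.

Set Implicit Arguments.
Unset Strict Implicit.
Unset Printing Implicit Defensive.

Import Order.TTheory GRing.Theory Num.Theory.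
Import numFieldNormedType.Exports.

Local Open Scope classical_set_scope.
Local Open Scope ring_scope.

(** Why the theorem holds.  Fix a uniformly discrete subpair Z, put
   G = K(Z,A), and write <h,u> for the sum of h(x) u(x) when h is a finitely
   supported function on G.  On a character chi of G, <h,chi> is the Fourier
   transform h^(chi).

   Let phi be one of the generators lam o f o i_Z of the variety V = V_Z(f).
   Since f is Lipschitz and lam continuous, phi is the pointwise limit of
   phi_n = lam o f o i_(Y_n) o P_n, and phi_n(x) is the integral of chi(x)
   against the pushforward nu_n.  As the total variations of the nu_n are
   bounded, |<h,phi>| <= K sup_chi |h^(chi)| with K independent of h
   ([cintegral_le], [sup_bounded_limit]).  This inequality is Eberlein's
   criterion for phi to lie in B(G), and it serves in place of a limit of the
   measures nu_n.

   The rest is duality between functions on G with pointwise convergence and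
   finitely supported functions.  By Hahn-Banach in that duality
   ([closure_of_kills]) it suffices that every g whose transform vanishes at
   all characters in V satisfies <g,phi> = 0.  The h that annihilate V form a
   convolution ideal I, and again by Hahn-Banach a character lies in V exactly
   when all transforms of elements of I vanish at it.  So g^ vanishes on the
   hull of I, and in the sup norm over the compact dual g^ is a limit of
   transforms of elements of I.  Concretely ([pairing_eq0_of_sup_bounded]):
   given eps, compactness yields q in I, a sum of multiples of h* h with h in
   I, such that q^ >= 0 everywhere and q^ > 1 wherever |g^| >= eps
   ([dominating_kills]).  For M >= sup q^ the function g (1 - q/M)^N
   (convolution powers) differs from g by an element of I, hence pairs with
   phi like g, while the sup norm of its transform is at most eps for large N.
   Therefore |<g,phi>| <= K eps. *)

(** * Duality with finitely supported functions *)

Section pairing.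
Context (R : realType) (G : zmodType).
Local Notation C := R[i].
Local Notation CG := {ptws G -> R[i]^o}.
Implicit Types (h k : seq (C * G)) (u v : G -> C).

(** A finitely supported function on G is encoded as a formal combination of
   point masses: a list of (coefficient, point) pairs in which points may
   repeat, so that sums are concatenations and no normal form is needed. *)
Definition pairing h u : C := \sum_(p <- h) p.1 * u p.2.

Definition kills h (S : set CG) := forall v, S v -> pairing h v = 0.

Definition scale (c : C) h : seq (C * G) := [seq (c * p.1, p.2) | p <- h].

Definition convolution h k : seq (C * G) :=
  flatten [seq [seq (p.1 * q.1, p.2 + q.2) | q <- k] | p <- h].

Definition involution h : seq (C * G) := [seq (p.1^*, - p.2) | p <- h].

Definition l1_norm h : C := \sum_(p <- h) `|p.1|.

Lemma pairing_cat h k u : pairing (h ++ k) u = pairing h u + pairing k u.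
Proof. by rewrite /pairing big_cat. Qed.

Lemma pairing_cons p h u : pairing (p :: h) u = p.1 * u p.2 + pairing h u.
Proof. by rewrite /pairing big_cons. Qed.

Lemma pairing_scale c h u : pairing (scale c h) u = c * pairing h u.
Proof.
by rewrite /pairing big_map big_distrr; apply: eq_bigr => p _ /=; rewrite mulrA.
Qed.

Lemma pairing_lin h c u v :
  pairing h (fun x => c * u x + v x) = c * pairing h u + pairing h v.
Proof.
rewrite /pairing big_distrr -big_split; apply: eq_bigr => p _ /=.
by rewrite mulrDr mulrCA.
Qed.

Lemma pairing0 h : pairing h (fun=> 0) = 0.
Proof. by rewrite /pairing big1 // => p _; rewrite mulr0. Qed.

Lemma pairing_convolution h k u :
  pairing (convolution h k) u =
  \sum_(p <- h) p.1 * pairing k (fun x => u (x + p.2)).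
Proof.
rewrite /pairing big_flatten big_map; apply: eq_bigr => p _.
rewrite big_map big_distrr; apply: eq_bigr => q _ /=.
by rewrite mulrA addrC.
Qed.

(** This is the finite-dimensional part of Hahn-Banach. Points are treated one
   at a time. A w in S with w x <> 0 splits S into the line of w and the
   functions of S vanishing at x; a functional h that kills the latter is turned
   into one that kills S by adding a suitable point mass at x. *)
Lemma interpolation (s : seq G) (S : set CG) (u : CG) : linear_subspace S ->
  (forall h, kills h S -> pairing h u = 0) ->
  exists2 v, S v & {in s, forall x, v x = u x}.
Proof.
elim: s S u => [|x s IH] S u [S0 SL] Su; first by exists (fun=> 0).
have [[w Sw wx]|noS] := pselect (exists2 w, S w & w x != 0); last first.
  have Sx v : S v -> v x = 0.
    by move=> Sv; apply/eqP; apply: contra_notT noS => vx; exists v.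
  have point_mass v : pairing [:: (1, x)] v = v x.
    by rewrite /pairing big_seq1 mul1r.
  have ux : u x = 0.
    by rewrite -point_mass; apply: Su => v Sv; rewrite point_mass Sx.
  have [v Sv vu] := IH S u (conj S0 SL) Su.
  by exists v => // y; rewrite inE => /predU1P[->|/vu//]; rewrite ux Sx.
pose S' : set CG := [set v | S v /\ v x = 0].
have S'L : linear_subspace S'.
  split=> // c v v' [Sv vx] [Sv' vx']; split; first exact: SL.
  by rewrite vx vx' mulr0 addr0.
pose u' : CG := fun y => - (u x / w x) * w y + u y.
have Su' h : kills h S' -> pairing h u' = 0.
  move=> hS'; rewrite pairing_lin.
  pose h' := (- (pairing h w / w x), x) :: h.
  have h'E v : pairing h' v = pairing h (fun y => - (v x / w x) * w y + v y).
    rewrite pairing_lin pairing_cons /=; congr (_ + _).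
    by rewrite mulNr mulNr; congr (- _); rewrite mulrC mulrCA mulrC.
  rewrite -pairing_lin -h'E; apply: Su => v Sv; rewrite h'E; apply: hS'.
  split; first exact: SL.
  by rewrite mulNr divfK // addNr.
have [v [Sv vx] vu] := IH S' u' S'L Su'.
exists (fun y => (u x / w x) * w y + v y); first exact: SL.
move=> y; rewrite inE => /predU1P[->|/vu ->]; first by rewrite vx addr0 divfK.
by rewrite /u' mulNr addNKr.
Qed.

End pairing.

Section closure_by_duality.
Context (R : realType) (G : zmodType).
Local Notation CG := {ptws G -> R[i]^o}.

Lemma cvg_ptwsP (F : set_system CG) (u : CG) : Filter F ->
  (forall x, (fun v : CG => v x : R[i]^o) @ F --> (u x : R[i]^o)) -> F --> u.
Proof.
move=> FF Fu; apply/cvg_sup => x U [V [[W oW <-] /= Wx WU]].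
have FW : F [set v : CG | W (v x)] by apply: (Fu x); exact: open_nbhs_nbhs.
by apply: (filterS _ FW) => v Wv; apply: WU.
Qed.

(** The functions of S agreeing with u on larger and larger finite sets form a
   filter base, nonempty by interpolation, that converges to u pointwise. *)
Lemma closure_of_kills (S : set CG) (u : CG) : linear_subspace S ->
  (forall h, kills h S -> pairing h u = 0) -> closure S u.
Proof.
move=> SL Su; rewrite closureEcvg.
pose agree (s : seq G) : set CG := [set v | S v /\ {in s, forall x, v x = u x}].
exists (filter_from [set: seq G] agree).
  apply: filter_from_proper; last first.
    by move=> s _; have [v Sv vu] := interpolation s SL Su; exists v.
  apply: filter_fromT_filter; first by exists [::].
  move=> s t; exists (s ++ t) => v [Sv vu].
  by split; split=> // x xs; apply: vu; rewrite mem_cat xs ?orbT.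
split; last by move=> B SB; exists [::] => // v [Sv _]; exact: SB.
apply: cvg_ptwsP => [|x].
  apply: filter_from_filter; first by exists [::].
  move=> s t _ _; exists (s ++ t) => // v [Sv vu].
  by split; split=> // x xs; apply: vu; rewrite mem_cat xs ?orbT.
move=> U /nbhs_singleton Ux; exists [:: x] => // v [_ vu] /=.
by rewrite /= vu ?mem_head.
Qed.

Lemma continuous_pairing (h : seq (R[i] * G)) :
  continuous (fun u : CG => pairing h u : R[i]^o).
Proof.
elim: h => [|p h IH] u.
  have -> : (fun u : CG => pairing [::] u : R[i]^o) = cst 0.
    by apply/funext => v; rewrite /pairing big_nil.
  exact: cst_continuous.
have -> : (fun u : CG => pairing (p :: h) u : R[i]^o) =
    (fun u : CG => p.1 *: (u p.2 : R[i]^o)) + (fun u : CG => pairing h u : R[i]^o).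
  by apply/funext => v; rewrite pairing_cons.
have cvgh := IH u.
have cvgp : (fun v : CG => p.1 *: (v p.2 : R[i]^o)) @ u --> p.1 *: (u p.2 : R[i]^o).
  have up : (fun v : CG => v p.2 : R[i]^o) @ u --> (u p.2 : R[i]^o).
    exact: (@proj_continuous G (fun=> R[i]^o) p.2 u).
  exact: (@cvgZl_tmp _ _ _ _ (nbhs_filter u) p.1 _ _ up).
exact: (@cvgD R[i] R[i]^o CG _ _ _ _ _ _ cvgp cvgh).
Qed.

Lemma closed_kills (h : seq (R[i] * G)) :
  closed [set u : CG | pairing h u = 0].
Proof.
have -> : [set u : CG | pairing h u = 0] =
    (fun u : CG => pairing h u : R[i]^o) @^-1` [set 0] by [].
apply: preimage_closed => [u _|]; first exact: continuous_pairing.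
exact/accessible_closed_set1/hausdorff_accessible/norm_hausdorff.
Qed.

End closure_by_duality.

(** * Complex numbers as a topological space *)

Section complex_topology.
Context (R : realType).
Local Notation C := R[i].

Lemma normc_le_ReIm (z : C) : `|z| <= (`|complex.Re z| + `|complex.Im z|)%:C%C.
Proof.
rewrite normc_def lecR.
have h0 : 0 <= `|complex.Re z| + `|complex.Im z| by rewrite addr_ge0.
rewrite -(ger0_norm h0) -sqrtr_sqr ler_wsqrtr // sqrrD !real_normK ?num_real //.
by rewrite -addrA [X in _ <= _ + X]addrC addrA lerDl mulrn_wge0 // mulr_ge0.
Qed.

Lemma normc_ge_Im (z : C) : `|complex.Im z|%:C%C <= `|z|.
Proof.
by rewrite normc_def lecR -sqrtr_sqr ler_wsqrtr // lerDr sqr_ge0.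
Qed.

Lemma continuous_Re : continuous (fun z : C^o => complex.Re z : R).
Proof.
move=> z U /nbhs_ballP[e /= e0 eU]; exists e%:C%C; first by rewrite /= ltcR.
move=> w /= zw; apply: eU; rewrite /ball /= -ltcR; apply: le_lt_trans zw.
by rewrite -raddfB; exact: normc_ge_Re.
Qed.

Lemma continuous_Im : continuous (fun z : C^o => complex.Im z : R).
Proof.
move=> z U /nbhs_ballP[e /= e0 eU]; exists e%:C%C; first by rewrite /= ltcR.
move=> w /= zw; apply: eU; rewrite /ball /= -ltcR; apply: le_lt_trans zw.
by rewrite -raddfB; exact: normc_ge_Im.
Qed.

(** It stands in for the unit disc as a compact set containing all values of
   characters, being a continuous image of a product of two segments. *)
Lemma compact_unit_square :
  compact [set z : C^o | `|complex.Re z| <= 1 /\ `|complex.Im z| <= 1].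
Proof.
have -> : [set z : C^o | `|complex.Re z| <= 1 /\ `|complex.Im z| <= 1] =
   (fun p : R * R => (p.1 +i* p.2)%C : C^o) @` (`[-1, 1] `*` `[-1, 1]).
  apply/seteqP; split => [[a b] /= [a1 b1]|_ [[a b] /= [a1 b1] <-]].
    by exists (a, b) => //=; split; rewrite /= in_itv /= -ler_norml.
  by move: a1 b1; rewrite !in_itv /= -!ler_norml.
apply: continuous_compact; last first.
  by apply: compact_setX; exact: segment_compact.
apply: continuous_subspaceT => -[a b] U [e /= e0 eU].
have er : (complex.Re e)%:C%C = e by apply: RRe_real; exact: gtr0_real.
have e'0 : 0 < complex.Re e / 2 by rewrite divr_gt0 // -ltcR er.
exists (ball a (complex.Re e / 2), ball b (complex.Re e / 2)).
  by split; exact: nbhsx_ballx.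
move=> [a' b'] [/= aa bb]; apply: eU => /=.
apply: le_lt_trans (normc_le_ReIm _) _; rewrite -er ltcR /=.
by rewrite [ltRHS]splitr ltrD.
Qed.

End complex_topology.

(** * The compact space of characters *)

Section characters.
Context (R : realType) (G : zmodType).
Local Notation C := R[i].
Local Notation CG := {ptws G -> R[i]^o}.
Implicit Types (chi : CG) (h g q : seq (C * G)).

Lemma closed_characters : closed [set chi : CG | is_character chi].
Proof.
have -> : [set chi : CG | is_character chi] =
    (\bigcap_(p in [set: G * G]) [set u : CG | u (p.1 + p.2) - u p.1 * u p.2 = 0])
    `&` (\bigcap_(x in [set: G]) [set u : CG | `|u x| = 1]).
  apply/seteqP; split => [u [uD u1]|u [uD u1]].
    by split=> [[x y] _|x _] //=; rewrite uD subrr.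
  by split=> [x y|x]; [apply/eqP; rewrite -subr_eq0; apply/eqP/(uD (x, y)) | exact: u1].
have ev (x : G) : continuous (fun u : CG => u x : R[i]^o).
  exact: (@proj_continuous G (fun=> R[i]^o) x).
apply: closedI; apply: closed_bigI.
  move=> [x y] _ /=.
  have -> : [set u : CG | u (x + y) - u x * u y = 0] =
     (fun u : CG => u (x + y) - u x * u y : R[i]^o) @^-1` [set 0] by [].
  apply: preimage_closed => [u _|]; last first.
    exact/accessible_closed_set1/hausdorff_accessible/norm_hausdorff.
  have cxy := ev (x + y) u; have cx := ev x u; have cy := ev y u.
  exact: (@cvgB _ _ _ _ _ _ _ _ _ cxy (@cvgM R[i] CG _ _ _ _ _ _ cx cy)).
move=> x _ /=.
have -> : [set u : CG | `|u x| = 1] =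
   (fun u : CG => (`|u x| : R[i]^o)) @^-1` [set 1] by [].
apply: preimage_closed => [u _|]; last first.
  exact/accessible_closed_set1/hausdorff_accessible/norm_hausdorff.
exact: (cvg_norm (ev x u)).
Qed.

Lemma compact_characters : compact [set chi : CG | is_character chi].
Proof.
have sq := @tychonoff G (fun=> R[i]^o) _ (fun=> @compact_unit_square R).
apply: (subclosed_compact closed_characters sq).
move=> chi [_ chi1] x /=.
have chi_le1 : `|chi x| <= 1%:C%C by rewrite chi1.
by split; rewrite -lecR; apply: le_trans chi_le1;
  [exact: normc_ge_Re|exact: normc_ge_Im].
Qed.

Section one_character.
Context (chi : CG) (chi_char : is_character chi).

Lemma character0 : chi 0 = 1.
Proof.
have [chiD chi1] := chi_char.
have chi0 : chi 0 != 0 by rewrite -normr_eq0 chi1 oner_neq0.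
by apply: (mulfI chi0); rewrite -chiD addr0 mulr1.
Qed.

Lemma characterN x : chi (- x) = (chi x)^*.
Proof.
have [chiD chi1] := chi_char.
have chix : chi x != 0 by rewrite -normr_eq0 chi1 oner_neq0.
by apply: (mulfI chix); rewrite -chiD subrr character0 -normCK chi1 expr1n.
Qed.

Lemma pairing_convolution_character h g :
  pairing (convolution h g) chi = pairing h chi * pairing g chi.
Proof.
have [chiD _] := chi_char.
rewrite pairing_convolution /pairing big_distrl; apply: eq_bigr => p _ /=.
rewrite -mulrA; congr (_ * _); rewrite big_distrr; apply: eq_bigr => q _ /=.
by rewrite chiD mulrCA mulrC mulrA [q.1 * _ * _]mulrAC mulrC mulrA.
Qed.

Lemma pairing_involution_character h :
  pairing (involution h) chi = (pairing h chi)^*.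
Proof.
rewrite /pairing rmorph_sum big_map; apply: eq_bigr => p _ /=.
by rewrite rmorphM characterN.
Qed.

Lemma pairing_character_le h : `|pairing h chi| <= l1_norm h.
Proof.
have [_ chi1] := chi_char.
apply: le_trans (ler_norm_sum _ _ _) _; apply: ler_sum => p _.
by rewrite normrM chi1 mulr1.
Qed.

End one_character.

Lemma kills_convolution (V : set CG) h q :
  (forall y u, V u -> V (fun x => u (x + y))) -> kills q V ->
  kills (convolution h q) V.
Proof.
move=> VT qV u Vu; rewrite pairing_convolution big1 // => p _.
by rewrite qV ?mulr0 //; exact: VT.
Qed.

End characters.

(** * Functions bounded by the sup norm of Fourier transforms *)

Section synthesis_of_bounded_functionals.
Context (R : realType) (G : zmodType).
Local Notation C := R[i].
Local Notation CG := {ptws G -> R[i]^o}.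
Implicit Types (chi phi : CG) (h g q : seq (C * G)).

(** Eberlein's criterion: for a function on a discrete abelian group it is
   equivalent to membership in B(G). *)
Definition sup_bounded phi := exists K : R, forall h (B : R),
  (forall chi, is_character chi -> `|pairing h chi| <= B%:C%C) ->
  `|pairing h phi| <= (K * B)%:C%C.

Definition nonneg_kills (V : set CG) q :=
  kills q V /\ forall chi, is_character chi -> 0 <= pairing q chi.

Definition dominated_at g (eps : R) q : set CG :=
  [set chi | `|pairing g chi| < eps%:C%C \/ 1 < complex.Re (pairing q chi)].

Lemma open_dominated_at g eps q : 0 < eps -> open (dominated_at g eps q).
Proof.
move=> eps0; rewrite /dominated_at.
have -> : [set chi | `|pairing g chi| < eps%:C%C \/ 1 < complex.Re (pairing q chi)]
   = ((fun chi : CG => pairing g chi : R[i]^o) @^-1` (ball (0 : R[i]^o) eps%:C%C)) `|`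
     ((fun chi : CG => complex.Re (pairing q chi)) @^-1` [set t | 1 < t]).
  by apply/seteqP; split => chi /=; rewrite /ball /= sub0r normrN.
apply: openU; apply: open_comp => /=.
- by move=> chi _; exact: continuous_pairing.
- by apply: ball_open; rewrite ltcR.
- move=> chi _.
  exact: (continuous_comp (@continuous_pairing R G q chi) (@continuous_Re R _)).
- exact: open_gt.
Qed.

Lemma nonneg_kills_cat V q q' :
  nonneg_kills V q -> nonneg_kills V q' -> nonneg_kills V (q ++ q').
Proof.
move=> [qV q0] [q'V q'0]; split=> [v Vv|chi chi_char]; rewrite pairing_cat.
  by rewrite qV // q'V // addr0.
by rewrite addr_ge0 ?q0 ?q'0.
Qed.

(** Where |g^| >= eps some h in the annihilator of V has h^ <> 0, and a multiple
   of h* h then works near that point. Compactness glues these: the required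
   property is stable under adding nonnegative elements of the annihilator, so
   it holds locally for all q far enough along the filter directed by domination
   of transforms, hence globally along it. *)
Lemma dominating_kills V g eps : 0 < eps ->
  (forall y u, V u -> V (fun x => u (x + y))) ->
  (forall chi, is_character chi ->
    (forall h, kills h V -> pairing h chi = 0) -> pairing g chi = 0) ->
  exists2 q, nonneg_kills V q &
    forall chi, is_character chi -> dominated_at g eps q chi.
Proof.
move=> eps0 VT gV.
pose above q : set (seq (C * G)) := [set q' | nonneg_kills V q' /\
  forall chi, is_character chi ->
    complex.Re (pairing q chi) <= complex.Re (pairing q' chi)].
have nilV : nonneg_kills V [::].
  by split=> [v _|? _]; rewrite /pairing big_nil.
have aboveF : ProperFilter (filter_from (nonneg_kills V) above).
  apply: filter_from_proper; last by move=> q qV; exists q.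
  apply: filter_from_filter; first by exists [::].
  move=> q q' qV q'V; exists (q ++ q'); first exact: nonneg_kills_cat.
  have Re_ge0 r : nonneg_kills V r -> forall chi, is_character chi ->
      0 <= complex.Re (pairing r chi).
    by move=> [_ r0] chi /r0; rewrite lecE /= => /andP[].
  move=> r [rV qr]; split; split=> // chi chi_char; apply: le_trans (qr _ chi_char);
    rewrite pairing_cat raddfD /= ?lerDl ?lerDr; exact: Re_ge0.
have /compact_near_coveringP cover := @compact_characters R G.
have /filter_ex[q [qV gq]] : \forall q \near filter_from (nonneg_kills V) above,
    nonneg_kills V q /\ [set chi : CG | is_character chi] `<=`
      (fun chi => is_character chi -> dominated_at g eps q chi).
  apply: filterI; first by exists [::] => // q [].
  pose dom q chi := is_character chi -> dominated_at g eps q chi.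
  apply: (cover _ _ dom (@filter_filter _ _ aboveF)) => chi chi_char.
  have [q0 q0V chi_q0] : exists2 q0, nonneg_kills V q0 & dominated_at g eps q0 chi.
    have [[h hV hchi]|noh] :=
      pselect (exists2 h, kills h V & pairing h chi != 0); last first.
      exists [::] => //.
      left; rewrite gV // ?normr0 ?ltcR // => h hV.
      by apply/eqP; apply: contra_notT noh => ?; exists h.
    (* The factor 2 / t makes the transform of h* h equal to 2 > 1 at chi. *)
    pose t := complex.Re (`|pairing h chi| ^+ 2).
    have tE : t%:C%C = `|pairing h chi| ^+ 2.
      by apply: RRe_real; rewrite ger0_real // exprn_ge0.
    have t0 : 0 < t by rewrite -ltcR tE exprn_gt0 // normr_gt0.
    exists (scale (2 / t)%:C%C (convolution (involution h) h)).
      split=> [v Vv|chi' chi'_char]; rewrite pairing_scale.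
        by rewrite (kills_convolution _ VT hV) // mulr0.
      rewrite pairing_convolution_character // pairing_involution_character //.
      rewrite [X in _ * X]mulrC -normCK mulr_ge0 ?exprn_ge0 //.
      by rewrite lecR divr_ge0 // ltW.
    right; rewrite pairing_scale pairing_convolution_character //.
    rewrite pairing_involution_character // [X in _ * X]mulrC -normCK -tE.
    rewrite -rmorphM /= divfK ?gt_eqF //.
    by rewrite ltr1n.
  exists (dominated_at g eps q0, above q0).
    split; last by exists q0.
    by apply: open_nbhs_nbhs; split=> //; exact: open_dominated_at.
  move=> [chi' q] [/= chi'q0 [_ q0q]] chi'_char.
  case: chi'q0 => [?|q01]; first by left.
  by right; apply: lt_le_trans q01 (q0q _ chi'_char).
by exists q => // chi chi_char; exact: gq.
Qed.

(** A quantitative form of the fact that, in the algebra of continuous functions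
   on a compact space, a closed ideal contains every function vanishing on its
   hull. Multiplying g^ by (1 - q^/M)^N is an approximate unit argument: it
   changes g only by elements of the annihilator of V, leaves |g^| < eps intact,
   and decays geometrically where q^ > 1. *)
Lemma pairing_eq0_of_sup_bounded V g phi :
  (forall y u, V u -> V (fun x => u (x + y))) ->
  (forall chi, is_character chi ->
    (forall h, kills h V -> pairing h chi = 0) -> pairing g chi = 0) ->
  V phi -> sup_bounded phi -> pairing g phi = 0.
Proof.
move=> VT gV Vphi [K phiK].
suff small (eps : R) : 0 < eps -> `|pairing g phi| <= (K * eps)%:C%C.
  pose a := complex.Re `|pairing g phi|.
  have aE : a%:C%C = `|pairing g phi| by apply: RRe_real; exact: normr_real.
  suff : a = 0 by move=> aE0; apply/eqP; rewrite -normr_eq0 -aE aE0.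
  have a0 : 0 <= a by rewrite -lecR aE; exact: normr_ge0.
  apply/eqP; rewrite eq_le a0 andbT; apply/ler_addgt0Pr => e e0; rewrite add0r.
  have K1 : 0 < `|K| + 1 by rewrite ltr_wpDl.
  have := small (e / (`|K| + 1)); rewrite divr_gt0 // => /(_ isT).
  rewrite -aE lecR => /le_trans; apply.
  rewrite mulrCA ger_pMr // ler_pdivrMr // mul1r.
  by rewrite (le_trans (ler_norm _)) // lerDl.
move=> eps0; have [q [qV q0] gq] := dominating_kills eps0 VT gV.
(* L and M - 1 are the l1 norms of g and q, bounding their transforms. *)
pose L := complex.Re (l1_norm g).
have LE : L%:C%C = l1_norm g.
  by apply: RRe_real; rewrite ger0_real // sumr_ge0.
pose M := complex.Re (l1_norm q) + 1.
have ME : l1_norm q <= M%:C%C.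
  rewrite rmorphD /= RRe_real ?lerDl ?ler01 //.
  by rewrite ger0_real // sumr_ge0.
have M1 : 1 <= M.
  by rewrite lerDr -lecR RRe_real ?ger0_real // sumr_ge0.
have M0 : 0 < M by rewrite (lt_le_trans ltr01).
pose theta := 1 - M^-1.
have theta0 : 0 <= theta by rewrite subr_ge0 invf_le1.
have theta1 : theta < 1 by rewrite ltrBlDr ltrDl invr_gt0.
have [N NP] : exists N, L * theta ^+ N <= eps.
  have : (fun N => L * theta ^+ N) @ \oo --> (0 : R).
    by apply: cvg_geometric; rewrite ger0_norm.
  move=> /cvgrPdist_le /(_ _ eps0) [N _ /(_ N (leqnn N))] /= LN.
  by exists N; rewrite (le_trans (ler_norm _)) // -normrN -sub0r.
(* e is the convolution identity minus q / M. *)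
pose e := (1, 0) :: scale (- M^-1)%:C%C q.
have e_phi h : pairing (convolution h e) phi = pairing h phi.
  rewrite pairing_convolution; apply: eq_bigr => p _; congr (_ * _).
  by rewrite pairing_cons pairing_scale (qV _ (VT _ _ Vphi)) mulr0 addr0 mul1r add0r.
pose gN n := iter n (fun h => convolution h e) g.
have gN_phi n : pairing (gN n) phi = pairing g phi.
  by elim: n => //= n <-; rewrite e_phi.
have gN_chi n chi : is_character chi ->
    pairing (gN n) chi = pairing g chi * (1 - pairing q chi / M%:C%C) ^+ n.
  move=> chi_char; elim: n => [|n IH]; first by rewrite mulr1.
  rewrite /= pairing_convolution_character // -/(gN n) IH exprSr mulrA.
  rewrite pairing_cons pairing_scale /= character0 // mulr1 rmorphN fmorphV mulNr.
  by rewrite [_^-1 * _]mulrC.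
rewrite -(gN_phi N); apply: phiK => chi chi_char.
rewrite gN_chi // normrM normrX.
pose r := complex.Re (pairing q chi).
have rE : pairing q chi = r%:C%C by rewrite RRe_real // ger0_real // q0.
have r0 : 0 <= r by rewrite -lecR -rE; exact: q0.
have rM : r <= M.
  by rewrite -lecR -rE -(ger0_norm (q0 _ chi_char))
    (le_trans (pairing_character_le chi_char q)).
have s0 : 0 <= 1 - r / M by rewrite subr_ge0 ler_pdivrMr // mul1r.
have -> : 1 - pairing q chi / M%:C%C = (1 - r / M)%:C%C.
  by rewrite rE rmorphB rmorphM fmorphV.
have -> : `|(1 - r / M)%:C%C| = (1 - r / M)%:C%C by apply: ger0_norm; rewrite lecR.
rewrite -rmorphXn.
case: (gq chi chi_char) => [/ltW g_eps|r1].
  apply: le_trans g_eps; rewrite ler_piMr //.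
  by rewrite lecR exprn_ile1 // lerBlDr lerDl divr_ge0 // ltW.
apply: (@le_trans _ _ (L * theta ^+ N)%:C%C); last by rewrite lecR.
rewrite [leRHS](_ : _ = L%:C%C * (theta ^+ N)%:C%C) ?rmorphM // LE.
apply: ler_pM; rewrite ?normr_ge0 ?pairing_character_le ?lecR ?exprn_ge0 //.
rewrite lerXn2r ?nnegrE // lerB // -[leLHS]mul1r ler_pM2r ?invr_gt0 //.
exact: ltW.
Qed.

End synthesis_of_bounded_functionals.

(** * Integration against charges and complex measures *)

Section bounded_measurable.
Context d (T : measurableType d) (R : realType).

Definition bounded_measurable (g : T -> R) :=
  measurable_fun setT g /\ exists B, forall x, `|g x| <= B.

Lemma bounded_measurable_lin c (g h : T -> R) :
  bounded_measurable g -> bounded_measurable h ->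
  bounded_measurable (fun x => c * g x + h x).
Proof.
move=> [mg [B gB]] [mh [B' hB']]; split.
  by apply: measurable_funD => //; exact: measurable_funM.
exists (`|c| * B + B') => x; apply: le_trans (ler_normD _ _) _.
by rewrite lerD // normrM ler_wpM2l.
Qed.

Lemma bounded_measurable_integrable (m : {measure set T -> \bar R}) (g : T -> R) :
  (m setT < +oo)%E -> bounded_measurable g -> m.-integrable setT (EFin \o g).
Proof.
move=> mfin [mg [B gB]]; apply: measurable_bounded_integrable => //.
exists B; split; rewrite ?num_real // => x Bx y _ /=.
exact: le_trans (gB y) (ltW Bx).
Qed.

Lemma normr_Rintegral_le (m : {measure set T -> \bar R}) (g : T -> R) B :
  (m setT < +oo)%E -> bounded_measurable g -> (forall x, `|g x| <= B) ->
  `|\int[m]_x g x| <= B * fine (m setT).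
Proof.
move=> mfin bg gB; have ig := bounded_measurable_integrable mfin bg.
apply: le_trans (le_normr_Rintegral _ ig) _ => //.
rewrite -Rintegral_cst //; apply: le_Rintegral => //.
  by have := integrable_norm ig.
apply: bounded_measurable_integrable => //; split; first exact: measurable_cst.
by exists `|B|.
Qed.

Lemma Rintegral_lin (m : {measure set T -> \bar R}) c (g h : T -> R) :
  (m setT < +oo)%E -> bounded_measurable g -> bounded_measurable h ->
  \int[m]_x (c * g x + h x) = c * \int[m]_x g x + \int[m]_x h x.
Proof.
move=> mfin bg bh; have ig := bounded_measurable_integrable mfin bg.
have ih := bounded_measurable_integrable mfin bh.
have icg : m.-integrable setT (EFin \o (fun x => c * g x)).
  have -> : (fun x => c * g x) = (fun x => c * g x + 0).
    by apply/funext => x; rewrite addr0.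
  apply: bounded_measurable_integrable => //; apply: bounded_measurable_lin => //.
  by split; [exact: measurable_cst|exists 0 => x; rewrite normr0].
by rewrite RintegralD // RintegralZl.
Qed.

End bounded_measurable.

Section charge_integral_theory.
Context d (T : measurableType d) (R : realType).
Implicit Type nu : {charge set T -> \bar R}.

Lemma jordan_finite nu P N (nuPN : hahn_decomposition nu P N) :
  (jordan_pos nuPN setT < +oo)%E /\ (jordan_neg nuPN setT < +oo)%E.
Proof. by split; rewrite ltey_eq fin_num_measure. Qed.

Lemma Rintegral_measure_add (m1 m2 : {measure set T -> \bar R}) (g : T -> R) :
  (m1 setT < +oo)%E -> (m2 setT < +oo)%E -> bounded_measurable g ->
  \int[measure_add m1 m2]_x g x = \int[m1]_x g x + \int[m2]_x g x.
Proof.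
move=> f1 f2 bg; have i1 := bounded_measurable_integrable f1 bg.
have i2 := bounded_measurable_integrable f2 bg.
rewrite /Rintegral (integral_measure_add measurableT i1 i2).
by rewrite fineD //; exact: integrable_fin_num.
Qed.

(** The integral against a charge depends only on the charge: two ways of writing
   it as a difference of finite measures, p - n = m1 - m2, give the equality
   p + m2 = m1 + n of measures, against which integration is additive. *)
Lemma charge_integralE nu (m1 m2 : {measure set T -> \bar R}) (g : T -> R) :
  (m1 setT < +oo)%E -> (m2 setT < +oo)%E ->
  (forall E, measurable E -> nu E = (m1 E - m2 E)%E) -> bounded_measurable g ->
  charge_integral nu g = \int[m1]_x g x - \int[m2]_x g x.
Proof.
move=> f1 f2 nuE bg; rewrite /charge_integral.
case: cid => P exP; case: cid => N nuPN.
have [fp fn] := jordan_finite nuPN.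
set p := jordan_pos nuPN in fp *; set n := jordan_neg nuPN in fn *.
apply/eqP; rewrite subr_eq addrAC eq_sym subr_eq eq_sym; apply/eqP.
rewrite -!Rintegral_measure_add //; congr fine.
apply: eq_measure_integral => E mE _.
transitivity (p E + m2 E)%E; first exact: measure_addE.
transitivity (m1 E + n E)%E; last exact/esym/measure_addE.
have fin (m : {measure set T -> \bar R}) : (m setT < +oo)%E -> m E \is a fin_num.
  move=> mfin; rewrite ge0_fin_numE //; apply: le_lt_trans mfin.
  by apply: le_measure; rewrite ?inE.
have swap (a b c e : \bar R) : a \is a fin_num -> b \is a fin_num ->
    c \is a fin_num -> e \is a fin_num -> (a - b = c - e)%E -> (a + e = c + b)%E.
  case: a => // a; case: b => // b; case: c => // c; case: e => // e _ _ _ _.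
  move=> /eqP; rewrite -!EFinB -!EFinD eqe => /eqP h; congr EFin.
  by apply/eqP; rewrite -subr_eq addrAC h subrK.
apply: swap; [exact: fin|exact: fin|exact: fin|exact: fin|].
by rewrite -nuE // (jordan_decomp nuPN mE) /cadd /= cscaleN1.
Qed.

Lemma charge_integral_jordan nu P N (nuPN : hahn_decomposition nu P N) g :
  bounded_measurable g -> charge_integral nu g =
    \int[jordan_pos nuPN]_x g x - \int[jordan_neg nuPN]_x g x.
Proof.
have [fp fn] := jordan_finite nuPN.
apply: charge_integralE => // E mE.
by rewrite (jordan_decomp nuPN mE) /cadd /= cscaleN1.
Qed.

Lemma charge_integral_lin nu c (g h : T -> R) :
  bounded_measurable g -> bounded_measurable h ->
  charge_integral nu (fun x => c * g x + h x) =
  c * charge_integral nu g + charge_integral nu h.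
Proof.
move=> bg bh; have [P [N nuPN]] := Hahn_decomposition nu.
have [fp fn] := jordan_finite nuPN.
rewrite !(charge_integral_jordan nuPN) //; last exact: bounded_measurable_lin.
rewrite !Rintegral_lin // mulrBr opprD -!addrA; congr (_ + _).
by rewrite addrCA.
Qed.

(** The hypothesis on K bounds the variation of the charge on two-set partitions,
   which is enough because a Hahn decomposition is one of them. *)
Lemma charge_integral_le nu (g : T -> R) B K : bounded_measurable g ->
  (forall x, `|g x| <= B) ->
  (forall P N, measurable P -> measurable N -> P `|` N = setT -> P `&` N = set0 ->
    `|fine (nu P)| + `|fine (nu N)| <= K) ->
  `|charge_integral nu g| <= B * K.
Proof.
move=> bg gB nuK; have [P [N nuPN]] := Hahn_decomposition nu.
have [fp fn] := jordan_finite nuPN.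
have [[mP _] [mN _] PN PN0] := nuPN.
have B0 : 0 <= B by exact: le_trans (normr_ge0 _) (gB point).
rewrite (charge_integral_jordan nuPN) //; apply: le_trans (ler_normB _ _) _.
have posE : fine (jordan_pos nuPN setT) <= `|fine (nu P)|.
  apply: le_trans _ (ler_norm _).
  rewrite [X in fine X](jordan_posE nuPN) cjordan_posE /crestr0 mem_set //=.
  by rewrite /crestr setTI.
have negE : fine (jordan_neg nuPN setT) <= `|fine (nu N)|.
  rewrite -normrN; apply: le_trans _ (ler_norm _).
  rewrite [X in fine X](jordan_negE nuPN) cjordan_negE /crestr0 mem_set //=.
  by rewrite /crestr setTI fineN.
apply: le_trans (ler_wpM2l B0 (nuK P N mP mN PN PN0)).
rewrite mulrDr; apply: lerD; apply: le_trans (normr_Rintegral_le _ bg gB) _ => //;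
  exact: ler_wpM2l.
Qed.

End charge_integral_theory.

Section cmeasure_theory.
Context d (T : measurableType d) (R : realType).
Local Notation C := R[i].
Implicit Type mu : cmeasure T R.

Definition cbounded_measurable (h : T -> C) :=
  bounded_measurable (fun x => complex.Re (h x)) /\
  bounded_measurable (fun x => complex.Im (h x)).

Lemma cintegral_lin mu (c : C) (g h : T -> C) :
  cbounded_measurable g -> cbounded_measurable h ->
  cintegral mu (fun x => c * g x + h x) = c * cintegral mu g + cintegral mu h.
Proof.
move=> [bg1 bg2] [bh1 bh2]; case: c => a b.
have ReE : (fun x => complex.Re ((a +i* b)%C * g x + h x)) =
    (fun x => a * complex.Re (g x) + (- b * complex.Im (g x) + complex.Re (h x))).
  by apply/funext => x; case: (g x) (h x) => [u v] [u' v'] /=; rewrite mulNr addrA.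
have ImE : (fun x => complex.Im ((a +i* b)%C * g x + h x)) =
    (fun x => a * complex.Im (g x) + (b * complex.Re (g x) + complex.Im (h x))).
  by apply/funext => x; case: (g x) (h x) => [u v] [u' v'] /=; rewrite addrA.
rewrite /cintegral ReE ImE.
rewrite !charge_integral_lin //; do ?exact: bounded_measurable_lin.
apply/eqP; rewrite eq_complex /=; apply/andP; split; apply/eqP; ring.
Qed.

(** The total variation of a complex measure controls its real and imaginary
   parts, since two-set partitions occur in the supremum defining it. *)
Lemma charge_part_variation mu K P N : (tv_norm mu <= K%:E)%E ->
  measurable P -> measurable N -> P `|` N = setT -> P `&` N = set0 ->
  `|fine (cmeasure_re mu P)| + `|fine (cmeasure_re mu N)| <= K /\
  `|fine (cmeasure_im mu P)| + `|fine (cmeasure_im mu N)| <= K.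
Proof.
move=> tvK mP mN PN PN0.
have le : Normc.normc (cmeasure_val mu P) + Normc.normc (cmeasure_val mu N) <= K.
  rewrite -lee_fin; apply: le_trans tvK; apply: ereal_sup_ubound.
  exists 2%N, (fun i : 'I_2 => if i == ord0 then P else N); split.
  - by move=> i; case: ifP.
  - apply/trivIsetP => i j _ _; case: i => [[|[|//]] ?]; case: j => [[|[|//]] ?] //= _.
    by rewrite setIC.
  - rewrite -PN; apply/seteqP; split => [x [i _]|x [Px|Nx]].
    + by case: ifP => _ ?; [left|right].
    + by exists ord0.
    + by exists (lift ord0 ord0).
  - by rewrite !big_ord_recl big_ord0 addr0.
have normRe (z : C) : `|complex.Re z| <= Normc.normc z.
  by rewrite -lecR; exact: normc_ge_Re.
have normIm (z : C) : `|complex.Im z| <= Normc.normc z.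
  by rewrite -lecR; exact: normc_ge_Im.
split; apply: le_trans le; apply: lerD.
- exact: (normRe (cmeasure_val mu P)).
- exact: (normRe (cmeasure_val mu N)).
- exact: (normIm (cmeasure_val mu P)).
- exact: (normIm (cmeasure_val mu N)).
Qed.

(** The constant 4 comes from estimating real and imaginary parts of measure and
   integrand separately. *)
Lemma cintegral_le mu (h : T -> C) (B K : R) : cbounded_measurable h ->
  (forall x, `|h x| <= B%:C%C) -> (tv_norm mu <= K%:E)%E ->
  `|cintegral mu h| <= (4 * K * B)%:C%C.
Proof.
move=> [bRe bIm] hB tvK.
have ReB x : `|complex.Re (h x)| <= B.
  by rewrite -lecR; apply: le_trans (hB x); exact: normc_ge_Re.
have ImB x : `|complex.Im (h x)| <= B.
  by rewrite -lecR; apply: le_trans (hB x); exact: normc_ge_Im.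
have bound nu g : (forall P N, measurable P -> measurable N ->
      P `|` N = setT -> P `&` N = set0 ->
      `|fine ((nu : {charge set T -> \bar R}) P)| + `|fine (nu N)| <= K) ->
    bounded_measurable g -> (forall x, `|g x| <= B) ->
    `|charge_integral nu g| <= B * K.
  by move=> nuK bg gB; exact: charge_integral_le.
have part := charge_part_variation tvK.
have re g : bounded_measurable g -> (forall x, `|g x| <= B) ->
    `|charge_integral (cmeasure_re mu) g| <= B * K.
  by apply: bound => P N mP mN PN PN0; have [] := part P N mP mN PN PN0.
have im g : bounded_measurable g -> (forall x, `|g x| <= B) ->
    `|charge_integral (cmeasure_im mu) g| <= B * K.
  by apply: bound => P N mP mN PN PN0; have [] := part P N mP mN PN PN0.
apply: le_trans (normc_le_ReIm _) _; rewrite lecR /cintegral /=.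
have -> : 4 * K * B = (B * K + B * K) + (B * K + B * K) by ring.
apply: lerD; [apply: le_trans (ler_normB _ _) _|apply: le_trans (ler_normD _ _) _];
  by apply: lerD; [apply: re|apply: im].
Qed.

End cmeasure_theory.

Section change_of_variables.
Context d d' (T : measurableType d) (T' : measurableType d') (R : realType).
Context (f : T -> T') (mf : measurable_fun setT f).
Local Notation C := R[i].

Lemma bounded_measurable_comp (g : T' -> R) :
  bounded_measurable g -> bounded_measurable (g \o f).
Proof.
move=> [mg [B gB]]; split; first exact: measurableT_comp.
by exists B => x; exact: gB.
Qed.

(** The images of the two Jordan parts of a charge need not be mutually singular,
   so they are not the Jordan parts of the image; they still are finite measures
   whose difference is the image. *)
Lemma charge_integral_pushforward (nu : {charge set T -> \bar R}) (g : T' -> R) :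
  bounded_measurable g ->
  charge_integral (charge_pushforward mf nu) g = charge_integral nu (g \o f).
Proof.
move=> bg; have [P [N nuPN]] := Hahn_decomposition nu.
have [fp fn] := jordan_finite nuPN.
have bgf := bounded_measurable_comp bg.
rewrite (charge_integral_jordan nuPN bgf).
pose push (m : {measure set T -> \bar R}) : {measure set T' -> \bar R} :=
  measure_function_pushforward__canonical__measure_function_Measure m mf.
have pushE (m : {measure set T -> \bar R}) : (m setT < +oo)%E ->
    \int[push m]_x g x = \int[m]_x (g \o f) x.
  move=> mfin; rewrite /Rintegral; congr fine.
  apply: (integral_pushforward mf) => //.
    by apply/measurable_EFinP; case: bg.
  rewrite preimage_setT.
  exact: (bounded_measurable_integrable mfin bgf).
rewrite -(pushE _ fp) -(pushE _ fn); apply: charge_integralE => //.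
move=> E mE; have mfE : measurable (f @^-1` E).
  by rewrite -[X in measurable X]setTI; exact: mf.
by rewrite [LHS](jordan_decomp nuPN mfE) /cadd /= cscaleN1.
Qed.

Lemma cintegral_pushforward (mu : cmeasure T R) (h : T' -> C) :
  cbounded_measurable h ->
  cintegral (cpushforward mf mu) h = cintegral mu (h \o f).
Proof.
by move=> [bRe bIm]; rewrite /cintegral /= !charge_integral_pushforward.
Qed.

End change_of_variables.

(** * Fourier-Stieltjes transforms and their pointwise limits *)

Section fourier_stieltjes_bounds.
Context (R : realType) (G : zmodType).
Local Notation C := R[i].
Local Notation CG := {ptws G -> R[i]^o}.

Lemma measurable_continuous_dual (g : dual_group R G -> R) :
  continuous g -> measurable_fun setT (g : borel_dual R G -> R).
Proof.
move=> cg; apply: (measurability _ (RGenOpens.measurableE R)).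
move=> _ [_ [a [b ->]] <-]; rewrite setTI; apply: sub_sigma_algebra.
have /continuousP := cg; apply; exact: interval_open.
Qed.

Lemma cbounded_measurable_pairing (h : seq (C * G)) :
  cbounded_measurable (fun chi : borel_dual R G => pairing h (val chi)).
Proof.
have cval : continuous (fun chi : dual_group R G => pairing h (val chi) : C^o).
  move=> chi.
  exact: (continuous_comp (@initial_continuous _ _ _ chi)
    (@continuous_pairing R G h (val chi))).
have bnd (chi : dual_group R G) : `|pairing h (val chi)| <= l1_norm h.
  by apply: pairing_character_le; exact: set_mem (valP chi).
have lE : (complex.Re (l1_norm h))%:C%C = l1_norm h.
  by apply: RRe_real; rewrite ger0_real // sumr_ge0.
split; split.
- apply: measurable_continuous_dual => chi.
  exact: (continuous_comp (cval chi) (@continuous_Re R _)).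
- exists (complex.Re (l1_norm h)) => chi; rewrite -lecR lE.
  by apply: le_trans (bnd chi); exact: normc_ge_Re.
- apply: measurable_continuous_dual => chi.
  exact: (continuous_comp (cval chi) (@continuous_Im R _)).
- exists (complex.Re (l1_norm h)) => chi; rewrite -lecR lE.
  by apply: le_trans (bnd chi); exact: normc_ge_Im.
Qed.

Lemma pairing_cintegral (nu : cmeasure (borel_dual R G) R) (h : seq (C * G)) :
  pairing h (fun x => cintegral nu (fun chi => val chi x)) =
  cintegral nu (fun chi => pairing h (val chi)).
Proof.
have evalE (x : G) : (fun chi : borel_dual R G => val chi x : C) =
    (fun chi => pairing [:: (1, x)] (val chi)).
  by apply/funext => chi; rewrite /pairing big_seq1 mul1r.
elim: h => [|p h IH].
  rewrite /pairing big_nil.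
  have -> : (fun chi : borel_dual R G => \sum_(p <- [::]) p.1 * val chi p.2) =
      (fun chi => pairing [::] (val chi)) by [].
  have b0 := cbounded_measurable_pairing [::].
  have := cintegral_lin nu (- 1) b0 b0; rewrite mulN1r addNr => <-.
  by congr cintegral; apply/funext => chi; rewrite /pairing big_nil mulr0 addr0.
rewrite pairing_cons IH [in LHS]evalE -cintegral_lin; first last.
- exact: cbounded_measurable_pairing.
- exact: cbounded_measurable_pairing.
by congr cintegral; apply/funext => chi; rewrite pairing_cons /pairing big_seq1 mul1r.
Qed.

(** Each h sees only finitely many values of phi, so bounds with a common constant
   pass to pointwise limits; this replaces weak-star compactness of balls of
   measures. *)
Lemma sup_bounded_limit (phi_ : nat -> CG) (phi : CG) (K : R) :
  (forall x, (fun n => phi_ n x : C^o) @ \oo --> (phi x : C^o)) ->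
  (forall n h (B : R),
    (forall chi : CG, is_character chi -> `|pairing h chi| <= B%:C%C) ->
    `|pairing h (phi_ n)| <= (K * B)%:C%C) ->
  sup_bounded phi.
Proof.
move=> phi_cvg phi_K; exists K => h B hB.
have cvg_phi : phi_ @ \oo --> phi by exact: cvg_ptwsP.
have cvg_h : (fun n => pairing h (phi_ n) : C^o) @ \oo --> (pairing h phi : C^o).
  exact: (cvg_comp _ _ cvg_phi (@continuous_pairing R G h phi)).
apply/ler_addgt0Pr => e e0.
have : nbhs (pairing h phi : C^o) (ball (pairing h phi : C^o) e).
  exact: nbhsx_ballx.
move=> /cvg_h [n _ /(_ n (leqnn n))] /=; rewrite /ball /= => /ltW hn.
rewrite -(subrK (pairing h (phi_ n)) (pairing h phi)) addrC.
by apply: le_trans (ler_normD _ _) _; rewrite lerD // phi_K.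
Qed.

End fourier_stieltjes_bounds.

Lemma character_exponential_monomial (R : realType) (G : zmodType)
    (chi : {ptws G -> R[i]^o}) :
  is_character chi -> exponential_monomial chi.
Proof.
move=> [chiD chi1]; exists 0%N, (fun=> \0), (mpoly.mpolyC 0 1), chi; split.
  by split=> // x; rewrite -normr_eq0 chi1 oner_neq0.
by apply/funext => x; rewrite mpoly.mevalC mul1r.
Qed.

(** * Synthesis of varieties with sup-bounded generators *)

Section synthesis_theorem.
Context (R : realType) (G : zmodType).
Local Notation CG := {ptws G -> R[i]^o}.
Implicit Types (F V : set CG).

Lemma Var_variety F : is_variety (Var F).
Proof.
split.
- by apply: closed_bigI => V [[]].
- by split=> [V [[_ [V0 _] _] _] //|c u v Vu Vv V VF];
    have [[_ [_ VL] _] _] := VF; apply: VL; [exact: Vu|exact: Vv].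
- by move=> y u Vu V VF; have [[_ _ VT] _] := VF; apply: VT; exact: Vu.
Qed.

Lemma linear_span F : linear_subspace (smallest (@linear_subspace R G) F).
Proof.
by split=> [V [[]]//|c u v Vu Vv V VF]; have [[_ VL] _] := VF;
  apply: VL; [exact: Vu|exact: Vv].
Qed.

(** The bipolar of the set of characters in V, that is, the closed span of these
   characters, described by duality. *)
Definition bicharacters V : set CG :=
  [set u | forall g, kills g (V `&` [set chi | is_character chi]) ->
    pairing g u = 0].

(** Translation invariance: translating u amounts to translating g, which
   multiplies g^(chi) by a value of chi and so preserves its zeros. *)
Lemma bicharacters_variety V : is_variety (bicharacters V).
Proof.
split.
- have -> : bicharacters V = \bigcap_(g in
      [set g | kills g (V `&` [set chi | is_character chi])])
      [set u : CG | pairing g u = 0] by [].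
  by apply: closed_bigI => g _; exact: closed_kills.
- split=> [g _|c u v Vu Vv g gV]; first exact: pairing0.
  by rewrite pairing_lin Vu // Vv // mulr0 addr0.
- move=> y u Vu g gV.
  have -> : pairing g (fun x => u (x + y)) = pairing (convolution [:: (1, y)] g) u.
    by rewrite pairing_convolution big_seq1 mul1r.
  apply: Vu => chi [Vchi chi_char].
  by rewrite pairing_convolution_character // (gV chi) ?mulr0.
Qed.

(** The bipolar of the characters in V is a variety containing the generators, by
   the vanishing result above, hence it contains all of V; and it lies in the
   closed span of the exponential monomials of V, characters being such. *)
Lemma synthesizable_Var F :
  (forall phi, F phi -> sup_bounded phi) -> synthesizable (Var F).
Proof.
move=> Fbounded; set V := Var F.
have [Vclosed Vlin VT] := Var_variety F.
have VW : V `<=` bicharacters V.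
  apply: smallest_sub; first exact: bicharacters_variety.
  move=> phi Fphi g gV; apply: (pairing_eq0_of_sup_bounded VT).
  - move=> chi chi_char chiV; apply: gV; split=> //.
    by apply: Vclosed; exact: closure_of_kills Vlin _.
  - exact: sub_gen_smallest Fphi.
  - exact: Fbounded.
move=> u /VW Wu; apply: closure_of_kills; first exact: linear_span.
move=> g gS; apply: Wu => chi [Vchi chi_char]; apply: gS.
exact: sub_gen_smallest (conj Vchi (character_exponential_monomial chi_char)).
Qed.

End synthesis_theorem.

Theorem theorem1p3 (R : realType) (X : metricType R) (A : set X)
    (A_nonempty : A !=set0)
    (X_separable : exists2 S : set X, countable S & dense S)
    (collapse_metric : is_metric (dbar1 (@mdist R X) (A := A)))
    (E : completeNormedModType R[i]) (f : vpd A -> E)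
    (f_lipschitz : vpd_lipschitz (@mdist R X) f)
    (Y : nat -> subpair A)
    (Y_ud : forall n, uniformly_discrete (@mdist R X) (Y n))
    (eps : nat -> R)
    (eps_nonincr : nonincreasing_seq eps)
    (eps_cvg0 : eps n @[n --> \oo] --> (0 : R))
    (Y_net : forall n, is_net (@mdist R X) (eps n) (Y n))
    (P : forall (Z : subpair A) (n : nat),
      {additive sub_vpd Z -> sub_vpd (Y n)})
    (P_cvg : forall (Z : subpair A) (xi : sub_vpd Z),
      rho (@mdist R X) (sub_incl (Y n) (P Z n xi)) (sub_incl Z xi)
        @[n --> \oo] --> (0 : R))
    (mu : forall n, topdual E -> cmeasure (borel_dual R (sub_vpd (Y n))) R)
    (mu_rep : forall n (lam : topdual E),
      represents (mu n lam) (fun xi => lam (f (sub_incl (Y n) xi))))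
    (nu_bounded : forall Z : subpair A, uniformly_discrete (@mdist R X) Z ->
      forall lam : topdual E,
      (ereal_sup (range (fun n =>
         tv_norm (cpushforward (measurable_dual_map (P Z n)) (mu n lam))))
       < +oo)%E) :
  ud_spectral_synthesis (@mdist R X) f.
Proof.
move=> Z Zud; apply: synthesizable_Var => _ [lam _ <-].
have [K tvK] : exists K : R, forall n,
    (tv_norm (cpushforward (measurable_dual_map (P Z n)) (mu n lam)) <= K%:E)%E.
  have := nu_bounded Z Zud lam; set s := ereal_sup _ => sfin.
  exists (fine s) => n.
  have tvs : (tv_norm (cpushforward (measurable_dual_map (P Z n)) (mu n lam)) <= s)%E.
    by apply: ereal_sup_ubound; exists n.
  case: s sfin tvs => // _ /le_trans; apply; exact: leNye.
pose phi_ n : {ptws sub_vpd Z -> R[i]^o} :=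
  fun xi => lam (f (sub_incl (Y n) (P Z n xi))).
apply: (@sup_bounded_limit _ _ phi_ _ (4 * K)).
  move=> xi.
  have [L fL] := f_lipschitz.
  have f_cvg : (fun n => f (sub_incl (Y n) (P Z n xi))) @ \oo --> f (sub_incl Z xi).
    apply/cvgrPdist_lt => e e0.
    pose c := complex.Re e.
    have cE : c%:C%C = e by apply: RRe_real; exact: gtr0_real.
    have c0 : 0 < c by rewrite -ltcR cE.
    have Lrho : (fun n => L * rho (@mdist R X)
        (sub_incl (Y n) (P Z n xi)) (sub_incl Z xi)) @ \oo --> (0 : R).
      by rewrite -(mulr0 L); exact: cvgM (cvg_cst L) (P_cvg Z xi).
    move/cvgrPdist_lt : Lrho => /(_ _ c0); apply: filterS => n.
    rewrite sub0r normrN => Lc; rewrite distrC; apply: le_lt_trans (fL _ _) _.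
    by rewrite -cE ltcR; exact: le_lt_trans (ler_norm _) Lc.
  case: lam {tvK} @phi_ => lam lamc /=.
  exact: (cvg_comp _ _ f_cvg (lamc (f (sub_incl Z xi)))).
move=> n h B hB.
pose nu := cpushforward (measurable_dual_map (P Z n)) (mu n lam).
have phiE : phi_ n = (fun x => cintegral nu (fun chi => val chi x)).
  apply/funext => xi; rewrite /phi_ (proj2 (mu_rep n lam)).
  have -> : (fun chi : borel_dual R (sub_vpd Z) => val chi xi : R[i]) =
      (fun chi => pairing [:: (1, xi)] (val chi)).
    by apply/funext => chi; rewrite /pairing big_seq1 mul1r.
  rewrite cintegral_pushforward; last exact: cbounded_measurable_pairing.
  by congr cintegral; apply/funext => chi; rewrite /= /pairing big_seq1 mul1r.
rewrite phiE pairing_cintegral; apply: cintegral_le (tvK n).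
  exact: cbounded_measurable_pairing.
by move=> chi; apply: hB; exact: set_mem (valP chi).
Qed.
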